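(* Let $\mathbb{k}$ be a field of characteristic $0$ containing a primitive $n$-th root of unity $\omega$, let $H=T_{n^2}(\omega)$ be the Taft Hopf algebra, and let $A=A_n(\omega)=\mathbb{k}[z]/(z^n-\omega)$ with $u$ the image of $z$. Let $a_i=(\omega-1)^i\omega^{i(i+1)/2}$ and let $\rho:A\to H\otimes A$ be the algebra homomorphism determined by $$\rho(u)=\sum_{i=0}^{n-1}a_i\,x^ig^{-(i+1)}\otimes u^{i+1}$$ (this is well defined since $\rho(u)^n=\omega\,(1\otimes 1)$). Then $A$ is an $H$-comodule algebra via $\rho$, i.e. $(\mathrm{id}\otimes\rho)\rho=(\Delta\otimes\mathrm{id})\rho$, if and only if for all integers $0\le k,s\le n-1$, $$\sum_{\{0\le i_1,\dots,i_{s+1}\le k\ \mid\ \sum_{j=1}^{s+1}i_j=k\}}\omega^{\sum_{j=2}^{s+1}i_j(j-1)}=\begin{cases}\binom{k+s}{k}_{\omega} & \text{if } k+s<n,\\ 0 & \text{if } k+s\ge n.\end{cases}$$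
   Context: The Taft Hopf algebra is $H=T_{n^2}(\omega)=\mathbb{k}\langle x,g\mid x^n=0,\ g^n=1,\ xg=\omega gx\rangle$ with $\Delta(g)=g\otimes g$, $\Delta(x)=x\otimes 1+g\otimes x$, $\epsilon(g)=1$, $\epsilon(x)=0$, $S(g)=g^{-1}$, $S(x)=-g^{-1}x$. The $q$-binomial coefficient is $\binom{k+s}{k}_q=\frac{(1-q^{s+1})\cdots(1-q^{s+k})}{(1-q)\cdots(1-q^k)}$ (a polynomial in $q$), evaluated at $q=\omega$. *)

(* Defs.v *)
From HB Require Import structures.
From mathcomp Require Import all_boot all_order all_algebra.
Set Implicit Arguments. Unset Strict Implicit. Unset Printing Implicit Defensive.
Import Order.TTheory GRing.Theory Num.Theory.
Local Open Scope ring_scope.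

(* Generic finite-dimensional algebras given by a basis B and structure
   constants m a b c = coefficient of basis element c in the product a*b.
   Elements are coefficient vectors {ffun B -> K}. *)
Section Generic.
Variable K : fieldType.

Definition conv (B : finType) (m : B -> B -> B -> K) (f h : {ffun B -> K})
  : {ffun B -> K} :=
  [ffun c => \sum_(a : B) \sum_(b : B) f a * h b * m a b c].

Definition cpow (B : finType) (m : B -> B -> B -> K) (one f : {ffun B -> K})
  (k : nat) : {ffun B -> K} := iter k (conv m f) one.

Definition tmul (B1 B2 : finType) (m1 : B1 -> B1 -> B1 -> K)
  (m2 : B2 -> B2 -> B2 -> K) : (B1 * B2)%type -> (B1 * B2)%type -> (B1 * B2)%type -> K :=
  fun a b c => m1 a.1 b.1 c.1 * m2 a.2 b.2 c.2.

Definition tens (B1 B2 : finType) (f : {ffun B1 -> K}) (h : {ffun B2 -> K})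
  : {ffun (B1 * B2)%type -> K} := [ffun p => f p.1 * h p.2].

Definition scl (B : finType) (c : K) (f : {ffun B -> K}) : {ffun B -> K} :=
  [ffun b => c * f b].

Definition bvec (B : finType) (b : B) : {ffun B -> K} := [ffun c => (c == b)%:R].
End Generic.

Section Taft.
Variables (K : fieldType) (n : nat) (w : K).

(* Taft algebra H = T_{n^2}(w), basis g^a x^b (0 <= a, b < n), indexed by (a, b).
   (g^a x^b)(g^c x^d) = w^(b c) g^((a+c) mod n) x^(b+d)  (0 if b + d >= n). *)
Definition BH := ('I_n * 'I_n)%type.
Definition mH (a b c : BH) : K :=
  if ((c.1 : nat) == (a.1 + b.1) %% n)%N && ((c.2 : nat) == a.2 + b.2)%N
  then w ^+ (a.2 * b.1) else 0.
Definition oneH : {ffun BH -> K} :=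
  [ffun c : BH => (((c.1 : nat) == 0%N) && ((c.2 : nat) == 0%N))%:R].
Definition gH : {ffun BH -> K} :=
  [ffun c : BH => (((c.1 : nat) == 1 %% n)%N && ((c.2 : nat) == 0%N))%:R].
Definition xH : {ffun BH -> K} :=
  [ffun c : BH => (((c.1 : nat) == 0%N) && ((c.2 : nat) == 1%N))%:R].
Definition powH := cpow mH oneH.
Definition mulH := conv mH.
(* g^{-1} = g^{n-1} since g^n = 1 *)
Definition ginvH : {ffun BH -> K} := powH gH n.-1.

(* A = A_n(w) = k[z]/(z^n - w), basis u^c (0 <= c < n). *)
Definition BA := 'I_n.
Definition mA (a b c : BA) : K :=
  if (c : nat) == ((a + b) %% n)%N then (if (a + b < n)%N then 1 else w) else 0.
Definition oneA : {ffun BA -> K} := [ffun c : BA => ((c : nat) == 0%N)%:R].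
Definition uA : {ffun BA -> K} := [ffun c : BA => ((c : nat) == 1 %% n)%N%:R].
Definition powA := cpow mA oneA.

Definition mHA := tmul mH mA.
Definition oneHA := tens oneH oneA.
Definition mHH := tmul mH mH.
Definition oneHH := tens oneH oneH.

Definition a_coef (i : nat) : K := (w - 1) ^+ i * w ^+ (i * i.+1 %/ 2).

Definition rho_u : {ffun (BH * BA)%type -> K} :=
  \sum_(i < n) scl (a_coef i) (tens (mulH (powH xH i) (powH ginvH i.+1)) (powA uA i.+1)).

Definition rho (f : {ffun BA -> K}) : {ffun (BH * BA)%type -> K} :=
  \sum_(c : BA) scl (f c) (cpow mHA oneHA rho_u c).

Definition id_rho (F : {ffun (BH * BA)%type -> K}) : {ffun (BH * (BH * BA))%type -> K} :=
  \sum_(p : BH * BA) scl (F p) (tens (bvec K p.1) (rho (bvec K p.2))).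

(* comultiplication: algebra map with Delta(g) = g(x)g, Delta(x) = x(x)1 + g(x)x;
   Delta(g^a x^b) = Delta(g)^a Delta(x)^b *)
Definition Delta_g : {ffun (BH * BH)%type -> K} := tens gH gH.
Definition Delta_x : {ffun (BH * BH)%type -> K} := tens xH oneH + tens gH xH.
Definition Delta_basis (p : BH) : {ffun (BH * BH)%type -> K} :=
  conv mHH (cpow mHH oneHH Delta_g p.1) (cpow mHH oneHH Delta_x p.2).

Definition reassoc (F : {ffun ((BH * BH) * BA)%type -> K})
  : {ffun (BH * (BH * BA))%type -> K} := [ffun q => F ((q.1, q.2.1), q.2.2)].

Definition Delta_id (F : {ffun (BH * BA)%type -> K}) : {ffun (BH * (BH * BA))%type -> K} :=
  \sum_(p : BH * BA) scl (F p) (reassoc (tens (Delta_basis p.1) (bvec K p.2))).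

Definition comodule_coassoc : Prop :=
  forall f : {ffun BA -> K}, id_rho (rho f) = Delta_id (rho f).

(* q-binomial coefficient binom(k+s, k)_q as a polynomial in q *)
Definition qbinom_poly (k s : nat) : {poly K} :=
  (\prod_(1 <= t < k.+1) (1 - 'X^(s + t))) %/ (\prod_(1 <= t < k.+1) (1 - 'X^t)).

(* the combinatorial condition; tuples (i_1..i_{s+1}) are t : 'I_(s+1) -> 'I_(k+1),
   0-indexed so that the exponent sum_{j=2}^{s+1} i_j (j-1) becomes sum_j t_j * j *)
Definition comb_cond : Prop :=
  forall k s : nat, (k < n)%N -> (s < n)%N ->
    \sum_(t : {ffun 'I_s.+1 -> 'I_k.+1} | (\sum_(j < s.+1) (t j : nat) == k)%N)
        w ^+ (\sum_(j < s.+1) t j * j)%N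
    = (if (k + s < n)%N then (qbinom_poly k s).[w] else 0).
End Taft.

(* Main.v *)
(* Both sides of the equivalence hold.

   The sum over compositions is the complete homogeneous symmetric polynomial
   h_k(1, w, ..., w^s), which equals the Gaussian binomial coefficient by the
   q-Pascal rule; at a primitive n-th root of unity the product formula makes
   this coefficient vanish when k, s < n <= k + s.

   For coassociativity, put X = w (w - 1) x g^-1 (x) u. Then
   rho(u) = (sum_i X^i) (g^-1 (x) u) = (1 - X)^-1 (g^-1 (x) u), hence
   rho(u)^-1 = g (x) u^-1 + (1 - w) x (x) 1. By the q-binomial theorem the n-th power of
   this element is w^-1, so rho(u)^n = w, and both (id (x) rho) and (Delta (x) id) are
   algebra morphisms on H (x) A. They visibly agree on rho(u)^-1, hence on every
   power of rho(u). *)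
Require Import Defs.
From HB Require Import structures.
From mathcomp Require Import all_boot all_order all_algebra.
From mathcomp Require Import ring zify.
Set Implicit Arguments. Unset Strict Implicit. Unset Printing Implicit Defensive.
Import GRing.Theory.
Local Open Scope ring_scope.

(** * Gaussian binomial coefficients *)

Section QBinomial.
Variable R : comNzRingType.
Implicit Types (q : R) (k s : nat).

(** The Gaussian binomial binom(k+s, k)_q, built from the q-Pascal rule. No division occurs, so it
    can be evaluated at roots of unity; the inner [fix] recurses on [s] for a fixed [k]. *)
Fixpoint qbin q k s : R :=
  if k is k'.+1 then
    (fix row s := if s is s'.+1 then row s' + q ^+ s * qbin q k' s else 1) s
  else 1.

Lemma qbin0s q s : qbin q 0 s = 1. Proof. by []. Qed.

Lemma qbink0 q k : qbin q k 0 = 1. Proof. by case: k. Qed.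

Lemma qbinSS q k s :
  qbin q k.+1 s.+1 = qbin q k.+1 s + q ^+ s.+1 * qbin q k s.+1.
Proof. by []. Qed.

(** The product formula with denominators cleared, so it survives when some 1 - q^t vanishes. The
    Pascal step reduces to (1 - q^(s+1)) + q^(s+1) (1 - q^(k+1)) = 1 - q^(s+k+2). *)
Lemma qbin_prod q k s :
  qbin q k s * \prod_(1 <= t < k.+1) (1 - q ^+ t) =
  \prod_(1 <= t < k.+1) (1 - q ^+ (s + t)).
Proof.
elim: k s => [|k IHk] s; first by rewrite !big_geq // mulr1.
elim: s => [|s IHs]; first by rewrite qbink0 mul1r.
rewrite qbinSS mulrDl {}IHs -mulrA.
rewrite [\prod_(1 <= t < k.+2) (1 - q ^+ t)]big_nat_recr //=.
rewrite [qbin q k _ * _]mulrA IHk.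
rewrite big_nat_recl // (eq_bigr (fun t => 1 - q ^+ (s.+1 + t)));
  last by move=> t _; rewrite addnS.
rewrite [in RHS]big_nat_recr //=.
set N := \prod_(_ <= _ < _) _.
rewrite addn1 [q ^+ (s.+1 + _)]exprD; ring.
Qed.

(** Pascal's rule iterated in [k]. In terms of complete homogeneous polynomials, it sorts the
    monomials of h_k by the exponent [i] of the last variable q^(s+1). *)
Lemma qbin_recl q k s :
  qbin q k s.+1 = \sum_(i < k.+1) qbin q (k - i) s * (q ^+ s.+1) ^+ i.
Proof.
elim: k => [|k IHk]; first by rewrite big_ord_recl big_ord0 expr0 mulr1 addr0.
rewrite qbinSS IHk [in RHS]big_ord_recl subn0 expr0 mulr1; congr (_ + _).
rewrite mulr_sumr; apply: eq_bigr => i _.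
by rewrite /= /bump add1n subSS [(q ^+ _) ^+ _.+1]exprS mulrCA.
Qed.

(** The product of geometric series is the generating function of the h_k(1, q, ..., q^s);
    truncating at [N] does not affect degrees below [N]. *)
Lemma coef_prod_geometric q N k s : (k < N)%N ->
  (\prod_(j < s.+1) \sum_(i < N) (q ^+ j *: 'X) ^+ i)`_k = qbin q k s.
Proof.
have geo j i : (i < N)%N ->
    (\sum_(i < N) (q ^+ j *: 'X) ^+ i)`_i = (q ^+ j) ^+ i.
  move=> ltiN; rewrite coef_sum (bigD1 (Ordinal ltiN)) //= exprZn coefZ coefXn eqxx.
  rewrite mulr1 big1 ?addr0 // => l neq; rewrite exprZn coefZ coefXn.
  by case: eqP => [e|]; rewrite ?mulr0 //; case/eqP: neq; apply: val_inj.
elim: s k => [|s IHs] k ltkN.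
  by rewrite big_ord_recl big_ord0 mulr1 geo //= expr0 expr1n qbink0.
rewrite big_ord_recr /= coefMr qbin_recl; apply: eq_bigr => i _.
have le_ik := ltn_ord i.
by rewrite IHs ?geo //; apply: leq_ltn_trans ltkN; rewrite ?leq_subr -1?ltnS.
Qed.

Lemma sum_compositions q k s :
  \sum_(t : {ffun 'I_s.+1 -> 'I_k.+1} | (\sum_(j < s.+1) (t j : nat) == k)%N)
     q ^+ (\sum_(j < s.+1) t j * j)%N = qbin q k s.
Proof.
(* Truncating at [k.+1] makes the choices of one term per factor exactly the functions into
   ['I_k.+1]. *)
rewrite -(@coef_prod_geometric q k.+1) // bigA_distr_bigA /= coef_sum big_mkcond /=.
apply: eq_bigr => t _.
rewrite [X in (polyseq X)`__](eq_bigr (fun j : 'I_s.+1 => q ^+ (t j * j) *: 'X ^+ t j)); last first.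
  by move=> j _; rewrite exprZn -exprM mulnC.
rewrite scaler_prod !prodrXr coefZ coefXn eq_sym.
by case: eqP; rewrite ?mulr1 ?mulr0.
Qed.

End QBinomial.

Arguments qbin : simpl never.

Lemma rmorph_qbin (R S : comNzRingType) (f : {rmorphism R -> S}) (q : R) k s :
  f (qbin q k s) = qbin (f q) k s.
Proof.
elim: k s => [|k IHk] s; first by rewrite rmorph1.
elim: s => [|s IHs]; first by rewrite !qbink0 rmorph1.
by rewrite !qbinSS rmorphD rmorphM rmorphXn IHs IHk.
Qed.

(** Each 1 - X^t with t > 0 is a nonzero polynomial, so [qbin_prod] at ['X] makes the Euclidean
    division exact. *)
Lemma qbinom_polyE (K : fieldType) k s : qbinom_poly K k s = qbin 'X k s.
Proof.
rewrite /qbinom_poly -qbin_prod mulpK //.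
rewrite prodf_seq_neq0; apply/allP => t; rewrite mem_index_iota => /andP[t0 _].
by rewrite -opprB oppr_eq0 monic_neq0 // monicXnsubC.
Qed.

(** * Specialization to a primitive root of unity, and the q-binomial theorem *)

Section PrimitiveRoot.
Variables (K : fieldType) (n : nat) (w : K).
Hypothesis prim_w : n.-primitive_root w.

Lemma qbin_prim_eq0 k s : (k < n)%N -> (s < n)%N -> (n <= k + s)%N ->
  qbin w k s = 0.
Proof.
move=> ltkn ltsn le_n; have := qbin_prod w k s.
(* The numerator contains the factor 1 - w^n, at t = n - s; the denominator has only factors 1 - w^t
   with 0 < t < n, all nonzero. *)
rewrite [RHS](big_cat_nat (n := n - s)) /=; try lia.
rewrite [X in _ = _ * X]big_ltn; last by lia.
rewrite subnKC ?(ltnW ltsn) // prim_expr_order // subrr mul0r mulr0.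
move/eqP; rewrite mulf_eq0 => /orP[/eqP //|].
rewrite prodf_seq_eq0 => /hasP[t]; rewrite mem_index_iota /= => /andP[t0 tk].
rewrite subr_eq0 eq_sym -(prim_order_dvd prim_w) => /dvdn_leq; lia.
Qed.

Lemma comb_cond_prim : comb_cond n w.
Proof.
move=> k s ltkn ltsn; rewrite sum_compositions; case: ltnP => [_|/qbin_prim_eq0 -> //].
by rewrite qbinom_polyE -[_.[w]]/(horner_eval w _) rmorph_qbin /= /horner_eval hornerX.
Qed.

End PrimitiveRoot.

(** Moving [b] past [a ^+ i] costs q^i, which is the weight in the q-Pascal rule. *)
Lemma exprDn_qcomm (K : comNzRingType) (A : algType K) (q : K) (a b : A) n :
  b * a = q *: (a * b) ->
  (a + b) ^+ n = \sum_(i < n.+1) qbin q (n - i) i *: (a ^+ i * b ^+ (n - i)).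
Proof.
move=> ba; have baX i : b * a ^+ i = q ^+ i *: (a ^+ i * b).
  elim: i => [|i IHi]; first by rewrite !expr0 mulr1 mul1r scale1r.
  by rewrite !exprSr mulrA IHi -scalerAl -(mulrA _ b a) ba -scalerAr scalerA !mulrA.
elim: n => [|n IHn]; first by rewrite big_ord1 !expr0 mulr1 scale1r.
rewrite exprS IHn mulrDl !mulr_sumr.
(* The pure powers of [a] and [b] are split off on both sides; the inner terms then pair up by
   Pascal's rule. *)
rewrite [X in X + _]big_ord_recr [X in _ + X]big_ord_recl.
rewrite [RHS]big_ord_recl [X in _ = _ + X]big_ord_recr /= /bump add1n.
rewrite !subnn !subn0 !qbink0 !scale1r !expr0 !mulr1 !mul1r -!exprS.
rewrite [LHS]addrC -[LHS]addrA; congr (_ + _).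
rewrite addrA; congr (_ + _); rewrite -big_split /=; apply: eq_bigr => i _.
rewrite !add1n subSS; have ltin := ltn_ord i.
rewrite -(subnSK ltin) qbinSS -!scalerAr mulrA baX -scalerAl !mulrA -!exprS.
by rewrite -mulrA -exprS scalerA scalerDl addrC [_ * q ^+ _]mulrC.
Qed.

(** Every inner coefficient has both indices below [n] and sum [n], hence vanishes by
    [qbin_prim_eq0]. *)
Lemma exprDn_prim (K : fieldType) (A : algType K) (n : nat) (w : K) (a b : A) :
  n.-primitive_root w -> b * a = w *: (a * b) -> (a + b) ^+ n = a ^+ n + b ^+ n.
Proof.
move=> prim_w ba; have := prim_order_gt0 prim_w.
rewrite (exprDn_qcomm _ ba); case: n prim_w => // n prim_w _.
rewrite big_ord_recl big_ord_recr /= subn0 qbink0 scale1r expr0 mul1r.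
rewrite /bump add1n subnn qbin0s scale1r expr0 mulr1 [LHS]addrC; congr (_ + _).
rewrite big1 ?add0r // => i _; have ltin := ltn_ord i.
by rewrite (qbin_prim_eq0 prim_w) ?scale0r //; lia.
Qed.

(** * Algebras given by structure constants *)

Section Conv.
Variables (K : fieldType) (B : finType) (m : B -> B -> B -> K).
Implicit Types (f g h : {ffun B -> K}) (c : K).

Lemma ffun_bvecE f : f = \sum_b scl (f b) (bvec K b).
Proof.
apply/ffunP => b; rewrite sum_ffunE (bigD1 b) //= !ffunE eqxx mulr1.
by rewrite big1 ?addr0 // => a /negbTE ab; rewrite !ffunE eq_sym ab mulr0.
Qed.

Lemma ffun_bvec_ind (P : {ffun B -> K} -> Prop) :
  P 0 -> (forall f g, P f -> P g -> P (f + g)) ->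
  (forall c f, P f -> P (scl c f)) -> (forall b, P (bvec K b)) -> forall f, P f.
Proof. by move=> P0 PD PZ Pb f; rewrite (ffun_bvecE f); apply: big_ind => // b _; apply: PZ. Qed.

Lemma convDl f g h : conv m (f + g) h = conv m f h + conv m g h.
Proof.
apply/ffunP => c; rewrite !ffunE -big_split; apply: eq_bigr => a _ /=.
by rewrite -big_split; apply: eq_bigr => b _; rewrite /= !ffunE !mulrDl.
Qed.

Lemma convDr f g h : conv m f (g + h) = conv m f g + conv m f h.
Proof.
apply/ffunP => c; rewrite !ffunE -big_split; apply: eq_bigr => a _ /=.
by rewrite -big_split; apply: eq_bigr => b _; rewrite /= !ffunE mulrDr mulrDl.
Qed.

Lemma convZl c f g : conv m (scl c f) g = scl c (conv m f g).
Proof.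
apply/ffunP => d; rewrite !ffunE mulr_sumr; apply: eq_bigr => a _.
by rewrite mulr_sumr; apply: eq_bigr => b _; rewrite !ffunE !mulrA.
Qed.

Lemma convZr c f g : conv m f (scl c g) = scl c (conv m f g).
Proof.
apply/ffunP => d; rewrite !ffunE mulr_sumr; apply: eq_bigr => a _.
by rewrite mulr_sumr; apply: eq_bigr => b _; rewrite !ffunE; ring.
Qed.

Lemma conv0l f : conv m 0 f = 0.
Proof. by apply: (addIr (conv m 0 f)); rewrite -convDl !add0r. Qed.

Lemma conv0r f : conv m f 0 = 0.
Proof. by apply: (addIr (conv m f 0)); rewrite -convDr !add0r. Qed.

Lemma conv_assoc_bvec :
  (forall a b d : B, conv m (bvec K a) (conv m (bvec K b) (bvec K d)) =
                 conv m (conv m (bvec K a) (bvec K b)) (bvec K d)) ->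
  associative (conv m).
Proof.
move=> mA f g h; elim/ffun_bvec_ind: f => [|f1 f2 IH1 IH2|c f IH|a].
- by rewrite !conv0l.
- by rewrite !convDl IH1 IH2.
- by rewrite !convZl IH.
elim/ffun_bvec_ind: g => [|f1 f2 IH1 IH2|c f IH|b].
- by rewrite !conv0l !conv0r conv0l.
- by rewrite !(convDl, convDr) IH1 IH2.
- by rewrite !(convZl, convZr) IH.
elim/ffun_bvec_ind: h => [|f1 f2 IH1 IH2|c f IH|c].
- by rewrite !conv0r.
- by rewrite !convDr IH1 IH2.
- by rewrite !convZr IH.
exact: mA.
Qed.

Lemma conv_left_id_bvec one :
  (forall b, conv m one (bvec K b) = bvec K b) -> left_id one (conv m).
Proof.
move=> m1 f; elim/ffun_bvec_ind: f => [|f g IHf IHg|c f IH|//].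
- by rewrite conv0r.
- by rewrite convDr IHf IHg.
- by rewrite convZr IH.
Qed.

Lemma conv_right_id_bvec one :
  (forall b, conv m (bvec K b) one = bvec K b) -> right_id one (conv m).
Proof.
move=> m1 f; elim/ffun_bvec_ind: f => [|f g IHf IHg|c f IH|//].
- by rewrite conv0l.
- by rewrite convDl IHf IHg.
- by rewrite convZl IH.
Qed.

Lemma conv_bvec a b : conv m (bvec K a) (bvec K b) = finfun (m a b).
Proof.
apply/ffunP => c; rewrite !ffunE (bigD1 a) //= (bigD1 b) //= !ffunE !eqxx !mul1r.
rewrite !big1 ?addr0 // => [a' /negbTE ne|b' /negbTE ne].
  by rewrite big1 // => b' _; rewrite !ffunE ne !mul0r.
by rewrite !ffunE ne mulr0 mul0r.
Qed.

End Conv.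

Lemma tens_bvec (K : fieldType) (B1 B2 : finType) (p : B1 * B2) :
  tens (bvec K p.1) (bvec K p.2) = bvec K p.
Proof. by apply/ffunP => -[a b]; case: p => c d; rewrite !ffunE -natrM mulnb. Qed.

Lemma conv_tens (K : fieldType) (B1 B2 : finType) m1 m2
    (f1 h1 : {ffun B1 -> K}) (f2 h2 : {ffun B2 -> K}) :
  conv (tmul m1 m2) (tens f1 f2) (tens h1 h2) = tens (conv m1 f1 h1) (conv m2 f2 h2).
Proof.
have sum_pair (F : B1 * B2 -> K) : \sum_p F p = \sum_a \sum_b F (a, b).
  by rewrite pair_bigA /=; apply: eq_bigr => -[].
apply/ffunP => -[c1 c2]; rewrite !ffunE /= mulr_suml sum_pair.
apply: eq_bigr => a1 _; rewrite mulr_suml.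
under [LHS]eq_bigr => a2 _ do rewrite sum_pair.
rewrite [LHS]exchange_big /=; apply: eq_bigr => b1 _; rewrite mulr_sumr.
apply: eq_bigr => a2 _; rewrite mulr_sumr; apply: eq_bigr => b2 _.
by rewrite !ffunE /tmul /=; ring.
Qed.

(** * Structure-constant algebras as instances of [algType] *)

Record scAlg (K : fieldType) := ScAlg {
  sc_basis : finType;
  sc_mul : sc_basis -> sc_basis -> sc_basis -> K;
  sc_one : {ffun sc_basis -> K};
  sc_mulA : associative (conv sc_mul);
  sc_mul1l : left_id sc_one (conv sc_mul);
  sc_mul1r : right_id sc_one (conv sc_mul);
  sc_one_neq0 : sc_one != 0 }.

(* An alias, since finite functions already carry the pointwise product. *)
Definition elt (K : fieldType) (A : scAlg K) : Type := {ffun sc_basis A -> K}.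

Section EltAlgebra.
Variables (K : fieldType) (A : scAlg K).

HB.instance Definition _ := GRing.Zmodule.copy (elt A) {ffun sc_basis A -> K}.

HB.instance Definition _ := GRing.Zmodule_isNzRing.Build (elt A)
  (@sc_mulA K A) (@sc_mul1l K A) (@sc_mul1r K A)
  (fun f g h => convDl (@sc_mul K A) f g h) (@convDr K _ (@sc_mul K A)) (@sc_one_neq0 K A).

Lemma sclA (a b : K) (f : elt A) : scl a (scl b f : elt A) = scl (a * b) f.
Proof. by apply/ffunP => c; rewrite !ffunE mulrA. Qed.
Lemma scl1 : left_id 1 (@scl K (sc_basis A)).
Proof. by move=> f; apply/ffunP => c; rewrite !ffunE mul1r. Qed.
Lemma sclDr : right_distributive (@scl K (sc_basis A)) +%R.
Proof. by move=> a f g; apply/ffunP => c; rewrite !ffunE mulrDr. Qed.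
Lemma sclDl (f : elt A) : {morph (@scl K (sc_basis A))^~ f : a b / a + b}.
Proof. by move=> a b; apply/ffunP => c; rewrite !ffunE mulrDl. Qed.

HB.instance Definition _ := GRing.Zmodule_isLmodule.Build K (elt A)
  sclA scl1 sclDr sclDl.

HB.instance Definition _ := GRing.Lmodule_isLalgebra.Build K (elt A)
  (fun c f g => esym (convZl (@sc_mul K A) c f g)).

HB.instance Definition _ := GRing.Lalgebra_isAlgebra.Build K (elt A)
  (fun c f g => esym (convZr (@sc_mul K A) c f g)).

Lemma cpowE (f : elt A) k : cpow (@sc_mul K A) (@sc_one K A) f k = f ^+ k.
Proof. by elim: k => //= k IHk; rewrite exprS -IHk. Qed.

Definition eltb (b : sc_basis A) : elt A := bvec K b.

Lemma elt_sumE (f : elt A) : f = \sum_b f b *: eltb b.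
Proof. exact: ffun_bvecE. Qed.

Definition lin_ext (M : lmodType K) (F : sc_basis A -> M) (f : elt A) : M :=
  \sum_b f b *: F b.

Lemma lin_ext_linear (M : lmodType K) (F : sc_basis A -> M) : linear (lin_ext F).
Proof.
move=> c f g; rewrite /lin_ext scaler_sumr -big_split; apply: eq_bigr => b _ /=.
by rewrite !ffunE scalerDl scalerA.
Qed.

HB.instance Definition _ (M : lmodType K) (F : sc_basis A -> M) :=
  GRing.isLinear.Build K (elt A) M _ (lin_ext F) (lin_ext_linear F).

Lemma lin_ext_eltb (M : lmodType K) (F : sc_basis A -> M) b : lin_ext F (eltb b) = F b.
Proof.
rewrite /lin_ext (bigD1 b) //= ffunE eqxx scale1r big1 ?addr0 // => a /negbTE ab.
by rewrite ffunE ab scale0r.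
Qed.

Lemma linear_mul_basis (R : algType K) (phi : {linear elt A -> R}) :
  (forall a b, phi (eltb a * eltb b) = phi (eltb a) * phi (eltb b)) ->
  {morph phi : f g / f * g}.
Proof.
move=> phiM f g; rewrite (elt_sumE f) (elt_sumE g) mulr_suml !linear_sum mulr_suml.
apply: eq_bigr => a _; rewrite !mulr_sumr linear_sum; apply: eq_bigr => b _.
move: (f a) (g b) => c d.
have phiZ e x : phi (e *: x) = e *: phi x by exact: linearZ_LR.
by rewrite -scalerAr -scalerAl !phiZ phiM -scalerAr -scalerAl.
Qed.

End EltAlgebra.

(** * Tensor products of structure-constant algebras *)

Section Tensor.
Variables (K : fieldType) (A1 A2 : scAlg K).
Let m := tmul (@sc_mul K A1) (@sc_mul K A2).
Let one := tens (@sc_one K A1) (@sc_one K A2).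

Lemma tens_mulA : associative (conv m).
Proof. by apply: conv_assoc_bvec => a b c; rewrite -!tens_bvec !conv_tens !sc_mulA. Qed.

Lemma tens_mul1l : left_id one (conv m).
Proof.
by apply: conv_left_id_bvec => a; rewrite -tens_bvec conv_tens !sc_mul1l.
Qed.

Lemma tens_mul1r : right_id one (conv m).
Proof.
by apply: conv_right_id_bvec => a; rewrite -tens_bvec conv_tens !sc_mul1r.
Qed.

Lemma tens_one_neq0 : one != 0.
Proof.
have one_coef (A : scAlg K) : exists a, sc_one A a != 0.
  apply/existsP; apply: contraNT (sc_one_neq0 A); rewrite negb_exists => /forallP e.
  by apply/eqP/ffunP => a; rewrite ffunE; apply/eqP; rewrite -[_ == _]negbK.
have [[a1 ne1] [a2 ne2]] := (one_coef A1, one_coef A2).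
by apply/eqP => /ffunP/(_ (a1, a2))/eqP; rewrite !ffunE mulf_eq0 (negbTE ne1) (negbTE ne2).
Qed.

Definition tensAlg : scAlg K := ScAlg tens_mulA tens_mul1l tens_mul1r tens_one_neq0.

Definition tensE (f : elt A1) (h : elt A2) : elt tensAlg := tens f h.

Lemma tensE_mul f1 f2 h1 h2 : tensE f1 h1 * tensE f2 h2 = tensE (f1 * f2) (h1 * h2).
Proof. exact: conv_tens. Qed.

Lemma tensE11 : tensE 1 1 = 1. Proof. by []. Qed.

Lemma tensEX f h k : tensE f h ^+ k = tensE (f ^+ k) (h ^+ k).
Proof. by elim: k => // k IHk; rewrite !exprS IHk tensE_mul. Qed.

Lemma tensEDl f g h : tensE (f + g) h = tensE f h + tensE g h.
Proof. by apply/ffunP => p; rewrite !ffunE mulrDl. Qed.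

Lemma tensEDr f g h : tensE f (g + h) = tensE f g + tensE f h.
Proof. by apply/ffunP => p; rewrite !ffunE mulrDr. Qed.

Lemma tensEZl c f h : tensE (c *: f) h = c *: tensE f h.
Proof. by apply/ffunP => p; rewrite !ffunE mulrA. Qed.

Lemma tensEZr c f h : tensE f (c *: h) = c *: tensE f h.
Proof. by apply/ffunP => p; rewrite !ffunE mulrCA. Qed.

Lemma tensE0l h : tensE 0 h = 0.
Proof. by rewrite -(scale0r 0) tensEZl scale0r. Qed.

Lemma tensE0r f : tensE f 0 = 0.
Proof. by rewrite -(scale0r 0) tensEZr scale0r. Qed.

Lemma tensE_eltb (p : sc_basis tensAlg) : eltb p = tensE (eltb p.1) (eltb p.2).
Proof. exact/esym/tens_bvec. Qed.

End Tensor.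

(** * The Taft algebra and its coaction *)

Section TaftCoaction.
Variables (K : fieldType) (n : nat) (w : K).
Hypothesis prim_w : n.-primitive_root w.

Let n_gt0 : (0 < n)%N := prim_order_gt0 prim_w.

Let wn1 : w ^+ n = 1 := prim_expr_order prim_w.

Let w_neq0 : w != 0.
Proof. by apply: contraTneq (oner_neq0 K) => w0; rewrite -wn1 w0 expr0n gtn_eqF // eqxx. Qed.

(* The monomials g^a x^b and u^c for arbitrary exponents: reduction modulo
   g^n = 1, x^n = 0 and u^n = w is built in. *)
Definition gxH (a b : nat) : {ffun BH n -> K} :=
  [ffun c : BH n => (((c.1 : nat) == a %% n) && ((c.2 : nat) == b))%N%:R].

Definition uXA (c : nat) : {ffun BA n -> K} :=
  [ffun d : BA n => if (d : nat) == (c %% n)%N then w ^+ (c %/ n) else 0].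

Lemma gxH_eq0 a b : (n <= b)%N -> gxH a b = 0.
Proof.
move=> le_nb; apply/ffunP => -[i j]; rewrite !ffunE /=.
by rewrite [j == b :> nat]ltn_eqF ?andbF // (leq_trans _ le_nb).
Qed.

Lemma gxH_bvec a b (lt_b : (b < n)%N) :
  gxH a b = bvec K (Ordinal (ltn_pmod a n_gt0), Ordinal lt_b).
Proof. by apply/ffunP => -[i j]; rewrite !ffunE. Qed.

Lemma bvec_gxH (p : BH n) : bvec K p = gxH p.1 p.2.
Proof. by case: p => a b; apply/ffunP => -[i j]; rewrite !ffunE /= modn_small. Qed.

Lemma uXA_bvec c : uXA c = scl (w ^+ (c %/ n)) (bvec K (Ordinal (ltn_pmod c n_gt0) : BA n)).
Proof.
apply/ffunP => d; rewrite !ffunE -val_eqE /=.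
by case: eqP; rewrite ?mulr1 ?mulr0.
Qed.

Lemma bvec_uXA (c : BA n) : bvec K c = uXA c.
Proof.
apply/ffunP => d; rewrite !ffunE -val_eqE /= modn_small // divn_small //.
by case: eqP.
Qed.

(** If [b] or [d] reaches [n], both sides are 0. Otherwise [mH] sees [c] only modulo [n], and w^n =
    1 makes the unreduced exponent [b * c] equivalent. *)
Lemma conv_gxH a b c d :
  conv (mH w) (gxH a b) (gxH c d) = scl (w ^+ (b * c)) (gxH (a + c) (b + d)).
Proof.
have [le_nb|lt_b] := leqP n b.
  rewrite (gxH_eq0 a le_nb) conv0l gxH_eq0 ?(leq_trans le_nb) ?leq_addr //.
  by apply/ffunP => e; rewrite !ffunE mulr0.
have [le_nd|lt_d] := leqP n d.
  rewrite (gxH_eq0 c le_nd) conv0r gxH_eq0 ?(leq_trans le_nd) ?leq_addl //.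
  by apply/ffunP => e; rewrite !ffunE mulr0.
rewrite (gxH_bvec _ lt_b) (gxH_bvec _ lt_d) conv_bvec.
apply/ffunP => -[i j]; rewrite !ffunE /mH /= modnDm.
by case: ifP; rewrite ?mulr0 // mulr1 !exprM expr_mod // exprAC wn1 expr1n.
Qed.

(** The factor [w] in [mA] is the carry when remainders modulo [n] are added, as accounted for by
    [divnD]. *)
Lemma conv_uXA a b : conv (mA w) (uXA a) (uXA b) = uXA (a + b).
Proof.
rewrite !uXA_bvec convZl convZr conv_bvec; apply/ffunP => d.
rewrite !ffunE /mA -val_eqE /= modnDm; case: eqP; rewrite ?mulr0 // mulr1 divnD // !exprD => _.
by case: ltnP; rewrite ?mulr1 ?expr0 ?mulr1 // expr1 mulrA.
Qed.

Lemma oneH_gxH : oneH K n = gxH 0 0.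
Proof. by apply/ffunP => c; rewrite !ffunE mod0n. Qed.

Lemma oneA_uXA : oneA K n = uXA 0.
Proof. by apply/ffunP => c; rewrite !ffunE mod0n div0n expr0; case: eqP. Qed.

Lemma uA_uXA : uA K n = uXA 1.
Proof.
apply/ffunP => c; rewrite !ffunE; case: eqP => // _.
(* For n = 1 the exponent 1 does wrap around, but then the resulting factor [w] equals 1. *)
have [n1|n_neq1] := eqVneq n 1%N; last by rewrite divn_small ?expr0 //; lia.
by move: wn1; rewrite n1 divn1 => ->.
Qed.

Lemma mulH_assoc : associative (conv (mH (n := n) w)).
Proof.
apply: conv_assoc_bvec => a b c; rewrite !bvec_gxH !conv_gxH convZl convZr !conv_gxH.
by apply/ffunP => e; rewrite !ffunE !addnA !mulrA -!exprD; congr (w ^+ _ * _); ring.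
Qed.

Lemma mulH_1l : left_id (oneH K n) (conv (mH w)).
Proof.
apply: conv_left_id_bvec => a; rewrite oneH_gxH bvec_gxH conv_gxH.
by apply/ffunP => e; rewrite !ffunE mul1r.
Qed.

Lemma mulH_1r : right_id (oneH K n) (conv (mH w)).
Proof.
apply: conv_right_id_bvec => a; rewrite oneH_gxH bvec_gxH conv_gxH muln0 !addn0.
by apply/ffunP => e; rewrite !ffunE mul1r.
Qed.

Lemma oneH_neq0 : oneH K n != 0.
Proof.
rewrite oneH_gxH (gxH_bvec _ n_gt0); apply/eqP => /ffunP.
move/(_ (Ordinal (ltn_pmod 0 n_gt0), Ordinal n_gt0))/eqP.
by rewrite !ffunE eqxx oner_eq0.
Qed.

Definition taftAlg : scAlg K := ScAlg mulH_assoc mulH_1l mulH_1r oneH_neq0.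

Lemma mulA_assoc : associative (conv (mA (n := n) w)).
Proof. by apply: conv_assoc_bvec => a b c; rewrite !bvec_uXA !conv_uXA addnA. Qed.

Lemma mulA_1l : left_id (oneA K n) (conv (mA w)).
Proof.
by apply: conv_left_id_bvec => a; rewrite oneA_uXA bvec_uXA conv_uXA.
Qed.

Lemma mulA_1r : right_id (oneA K n) (conv (mA w)).
Proof.
by apply: conv_right_id_bvec => a; rewrite oneA_uXA bvec_uXA conv_uXA addn0.
Qed.

Lemma oneA_neq0 : oneA K n != 0.
Proof.
apply/eqP => /ffunP/(_ (Ordinal n_gt0))/eqP.
by rewrite !ffunE eqxx oner_eq0.
Qed.

Definition rootAlg : scAlg K := ScAlg mulA_assoc mulA_1l mulA_1r oneA_neq0.

Local Notation H := taftAlg.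
Local Notation A := rootAlg.
Local Notation HA := (tensAlg H A).
Local Notation HH := (tensAlg H H).
Local Notation HHA := (tensAlg H HA).

Definition gxE a b : elt H := gxH a b.
Definition uE c : elt A := uXA c.

Lemma gxE_mul a b c d : gxE a b * gxE c d = w ^+ (b * c) *: gxE (a + c) (b + d).
Proof. exact: conv_gxH. Qed.

Lemma gxE00 : gxE 0 0 = 1. Proof. exact/esym/oneH_gxH. Qed.

Lemma gxE_g a k : gxE a 0 ^+ k = gxE (k * a) 0.
Proof.
elim: k => [|k IHk]; first by rewrite mul0n gxE00.
by rewrite exprS IHk gxE_mul expr0 scale1r mulSn.
Qed.

Lemma gxE_x k : gxE 0 1 ^+ k = gxE 0 k.
Proof.
elim: k => [|k IHk]; first by rewrite gxE00.
by rewrite exprS IHk gxE_mul muln0 scale1r add1n.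
Qed.

Lemma gxE_eq0 a b : (n <= b)%N -> gxE a b = 0.
Proof. exact: gxH_eq0. Qed.

Lemma gxE_addn a b k : gxE (a + k * n) b = gxE a b.
Proof. by apply/ffunP => c; rewrite !ffunE addnC modnMDl. Qed.

Lemma gxE_gx a b : gxE 1 0 ^+ a * gxE 0 1 ^+ b = gxE a b.
Proof. by rewrite gxE_g gxE_x gxE_mul expr0 scale1r muln1 addn0. Qed.

Lemma uE_mul a b : uE a * uE b = uE (a + b).
Proof. exact: conv_uXA. Qed.

Lemma uE0 : uE 0 = 1. Proof. exact/esym/oneA_uXA. Qed.

Lemma uE_X c k : uE c ^+ k = uE (k * c).
Proof.
elim: k => [|k IHk]; first by rewrite mul0n uE0.
by rewrite exprS IHk uE_mul mulSn.
Qed.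

Lemma uE_addn c k : uE (c + k * n) = w ^+ k *: uE c.
Proof.
apply/ffunP => d; rewrite !ffunE addnC modnMDl divnMDl //.
by case: eqP; rewrite ?mulr0 // exprD.
Qed.

Definition gxuE a b c : elt HA := tensE (gxE a b) (uE c).

Lemma gxuE_mul a b c a' b' c' :
  gxuE a b c * gxuE a' b' c' = w ^+ (b * a') *: gxuE (a + a') (b + b') (c + c').
Proof. by rewrite tensE_mul gxE_mul uE_mul tensEZl. Qed.

Lemma gxuE000 : gxuE 0 0 0 = 1.
Proof. by rewrite /gxuE gxE00 uE0. Qed.

Lemma eltb_gxuE (p : sc_basis HA) : eltb p = gxuE p.1.1 p.1.2 p.2.
Proof. by rewrite tensE_eltb; congr tensE; [apply: bvec_gxH | apply: bvec_uXA]. Qed.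

(** * Morphisms out of H ⊗ A by generators and relations *)

Section Presentation.
Variables (R : algType K) (g x u : R).
Hypotheses (gn : g ^+ n = 1) (xn : x ^+ n = 0) (un : u ^+ n = w%:A).
Hypotheses (xg : x * g = w *: (g * x)) (ug : u * g = g * u) (ux : u * x = x * u).

(** The universal map attached to images of the three generators. Both id ⊗ rho and Delta ⊗ id will
    be recognized as instances. *)
Definition HAmorph : elt HA -> R :=
  lin_ext (fun p : sc_basis HA => g ^+ p.1.1 * x ^+ p.1.2 * u ^+ p.2).

HB.instance Definition _ := GRing.Linear.on HAmorph.

Lemma HAmorphZ c f : HAmorph (c *: f) = c *: HAmorph f.
Proof. exact: linearZ_LR. Qed.

Lemma HAmorphD f h : HAmorph (f + h) = HAmorph f + HAmorph h.
Proof. exact: linearD. Qed.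

(** The relations [gn], [xn] and [un] extend the formula from basis vectors to unreduced exponents,
    which is what products of monomials produce. *)
Lemma HAmorph_gxuE a b c : HAmorph (gxuE a b c) = g ^+ a * x ^+ b * u ^+ c.
Proof.
have [le_nb|lt_b] := leqP n b.
  rewrite /gxuE (gxE_eq0 _ le_nb) -(subnKC le_nb) exprD xn mul0r mulr0 mul0r.
  by rewrite tensE0l linear0.
pose p : sc_basis HA :=
  ((Ordinal (ltn_pmod a n_gt0), Ordinal lt_b), Ordinal (ltn_pmod c n_gt0)).
have -> : gxuE a b c = w ^+ (c %/ n) *: eltb p.
  have e1 : gxE a b = eltb (A := H) p.1 by exact: gxH_bvec.
  have e2 : uE c = w ^+ (c %/ n) *: eltb (A := A) p.2 by exact: uXA_bvec.
  by rewrite tensE_eltb -tensEZr -e1 -e2.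
rewrite HAmorphZ /HAmorph lin_ext_eltb /= expr_mod //.
rewrite [in RHS](divn_eq c n) addnC exprD (mulnC _ n) exprM un.
by rewrite exprZn expr1n mulr_algr -scalerAr.
Qed.

Lemma HAmorph1 : HAmorph 1 = 1.
Proof. by rewrite -gxuE000 HAmorph_gxuE !expr0 !mulr1. Qed.

(** Putting a product of two monomials in normal order moves x^b past g^a', producing the same
    factor w^(b a') as in [gxuE_mul]. *)
Lemma HAmorphM : {morph HAmorph : f h / f * h}.
Proof.
have xgX a b : x ^+ b * g ^+ a = w ^+ (b * a) *: (g ^+ a * x ^+ b).
  have xgX1 : x * g ^+ a = w ^+ a *: (g ^+ a * x).
    elim: a => [|a IHa]; first by rewrite !expr0 mulr1 mul1r scale1r.
    by rewrite !exprSr mulrA IHa -scalerAl -(mulrA _ x g) xg -scalerAr scalerA !mulrA.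
  elim: b => [|b IHb]; first by rewrite !expr0 mulr1 mul1r scale1r.
  by rewrite exprS -mulrA IHb -scalerAr (mulrA x) xgX1 -scalerAl scalerA -exprD mulrA mulSn addnC.
have uXg a c : u ^+ c * g ^+ a = g ^+ a * u ^+ c by apply: commrX; apply/commr_sym/commrX/esym.
have uXx b c : u ^+ c * x ^+ b = x ^+ b * u ^+ c by apply: commrX; apply/commr_sym/commrX/esym.
apply: linear_mul_basis => p q /=; rewrite !eltb_gxuE gxuE_mul HAmorphZ !HAmorph_gxuE.
rewrite !exprD !mulrA -(mulrA _ (u ^+ _) (g ^+ _)) uXg mulrA.
rewrite -(mulrA _ (x ^+ _) (g ^+ _)) xgX -!(scalerAr, scalerAl) !mulrA; congr (_ *: _).
by rewrite -!mulrA; congr (_ * _); congr (_ * _); congr (_ * _); rewrite !mulrA uXx.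
Qed.

Lemma HAmorphX f k : HAmorph (f ^+ k) = HAmorph f ^+ k.
Proof. by elim: k => [|k IHk]; rewrite ?HAmorph1 // !exprS HAmorphM IHk. Qed.

End Presentation.

(** * The element rho(u) and its inverse *)

Definition rhoE : elt HA := rho_u n w.

(** The inverse g ⊗ u^-1 + (1 - w) x ⊗ 1 of rho(u), with u^-1 written as w^-1 u^(n-1). *)
Definition rhoV : elt HA := w^-1 *: gxuE 1 0 n.-1 + (1 - w) *: gxuE 0 1 0.

(** The second factor comes from reordering x^i g^(-(i+1)) with powers of [g] first, where g^-1 =
    g^(n-1). *)
Definition rho_coef i : K := a_coef w i * w ^+ (i * (i.+1 * n.-1)).

Lemma powHE (f : elt H) k : powH w f k = f ^+ k. Proof. exact: (cpowE f k). Qed.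

Lemma powAE (f : elt A) k : powA w f k = f ^+ k. Proof. exact: (cpowE f k). Qed.

Lemma gH_gxE : gH K n = gxE 1 0. Proof. by apply/ffunP => c; rewrite !ffunE. Qed.

Lemma xH_gxE : xH K n = gxE 0 1. Proof. by apply/ffunP => c; rewrite !ffunE mod0n. Qed.

Lemma rhoE_sum : rhoE = \sum_(i < n) rho_coef i *: gxuE (i.+1 * n.-1) i i.+1.
Proof.
rewrite /rhoE /rho_u; apply: eq_bigr => i _.
have gVE : ginvH n w = gxE n.-1 0 by rewrite /ginvH gH_gxE powHE gxE_g muln1.
rewrite xH_gxE gVE [uA _ _]uA_uXA !powHE (powAE (uE 1)) gxE_x gxE_g uE_X muln1.
rewrite [mulH w _ _]conv_gxH.
by rewrite add0n addn0 /rho_coef -scalerA -tensEZl.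
Qed.

Lemma rho_coefS i : rho_coef i.+1 = rho_coef i * (w - 1) * w ^+ (i.+1 * n.-1).
Proof.
rewrite /rho_coef /a_coef.
have -> : (i.+1 * i.+2 %/ 2 = i * i.+1 %/ 2 + i.+1)%N.
  by rewrite addnC -divnMDl //; congr (_ %/ 2)%N; lia.
have -> : (i.+1 * (i.+2 * n.-1) = i * (i.+1 * n.-1) + i.+1 * n.-1 + i.+1 * n.-1)%N by ring.
(* The new factor w^(i+1) of [a_coef] cancels one of the two new factors w^((i+1)(n-1)). *)
have e : w ^+ (i.+1 + i.+1 * n.-1) = 1.
  by rewrite -mulnS prednK // mulnC exprM wn1 expr1n.
rewrite -[RHS]mulr1 -[X in _ = _ * X]e !exprD [(w - 1) ^+ _.+1]exprS.
move: (w ^+ (i.+1 * n.-1)) (w ^+ (i * (i.+1 * n.-1))) (w ^+ (i * i.+1 %/ 2)) (w ^+ i.+1) => *.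
by ring.
Qed.

(* The products of rhoV with the summands of rhoE telescope. *)
Lemma rhoV_rhoE : rhoV * rhoE = 1.
Proof.
rewrite rhoE_sum mulr_sumr.
pose T i := rho_coef i *: gxuE (i * n.-1) i i.
rewrite (eq_bigr (fun i : 'I_n => T i - T i.+1)); last first.
  move=> i _; rewrite /T mulrDl -!scalerAl -!scalerAr !gxuE_mul mul0n expr0 scale1r mul1n.
  (* Both exponents wrap around once: g^n = 1 disappears, while u^n = w cancels the [w^-1] in
     [rhoV]. *)
  have -> : (1 + i.+1 * n.-1 = i * n.-1 + 1 * n)%N.
    by rewrite mulSn mul1n addnA add1n prednK // addnC.
  have -> : (n.-1 + i.+1 = i + 1 * n)%N by rewrite mul1n addnS -addSn prednK // addnC.
  rewrite /gxuE gxE_addn uE_addn expr1 tensEZr rho_coefS !scalerA !add0n add1n; congr (_ + _).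
    by congr (_ *: _); field.
  by rewrite -scaleNr; congr (_ *: _); ring.
rewrite -(big_mkord xpredT (fun i => T i - T i.+1)).
under eq_bigr do rewrite -opprB.
(* Only the ends remain: [T n] is 0 because x^n = 0, and [T 0] is 1. *)
rewrite sumrN telescope_sumr // opprB {2}/T /gxuE gxE_eq0 //.
rewrite tensE0l scaler0 subr0 /T gxuE000.
by rewrite /rho_coef /a_coef !mul0n !expr0 !mulr1 scale1r.
Qed.

(** The two summands w-commute, so only their n-th powers survive; x^n = 0 removes one and the other
    contributes w^-n w^(n-1). *)
Lemma rhoV_n : rhoV ^+ n = w^-1%:A.
Proof.
rewrite /rhoV (exprDn_prim prim_w); last first.
  rewrite -!scalerAl -!scalerAr !gxuE_mul !scalerA expr1 expr0 mulr1 !addn0 !add0n.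
  by congr (_ *: _); ring.
rewrite !exprZn !tensEX gxE_x gxE_g (@gxE_eq0 0 n) // !uE_X.
rewrite tensE0l scaler0 addr0.
have -> : gxE (n * 1) 0 = 1 by rewrite mulnC -[(1 * n)%N]add0n gxE_addn gxE00.
have -> : uE (n * n.-1) = w ^+ n.-1 *: 1 by rewrite mulnC -[(n.-1 * n)%N]add0n uE_addn uE0.
rewrite tensEZr scalerA tensE11; congr (_ *: _).
rewrite -[X in _ ^+ X * _](prednK n_gt0) exprS exprVn -mulrA mulVf ?mulr1 //.
by rewrite expf_neq0.
Qed.

(** Multiply [rhoV_n] by [rhoE] on the right. Being a multiple of a power of [rhoV], [rhoE] is also
    a right inverse, and morphisms that agree on [rhoV] agree on it. *)
Lemma rhoE_rhoV : rhoE = w *: rhoV ^+ n.-1.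
Proof.
have := rhoV_n; rewrite -{1}(prednK n_gt0) exprSr => /(congr1 ( *%R^~ rhoE)).
rewrite /= -mulrA rhoV_rhoE mulr1 mulr_algl => ->.
by rewrite scalerA divff // scale1r.
Qed.

Lemma rhoE_mul_rhoV : rhoE * rhoV = 1.
Proof.
by rewrite rhoE_rhoV -scalerAl -exprSr prednK // rhoV_n scalerA divff // scale1r.
Qed.

Lemma rhoE_n : rhoE ^+ n = w%:A.
Proof.
rewrite rhoE_rhoV exprZn -exprM mulnC exprM rhoV_n exprZn expr1n scalerA wn1 mul1r.
congr (_ *: _); rewrite exprVn; apply: (mulIf (expf_neq0 n.-1 w_neq0)).
by rewrite mulVf ?expf_neq0 // -exprS prednK.
Qed.

(** Evaluates id ⊗ rho on the factor u^(n-1) that occurs in [rhoV]. *)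
Lemma rhoE_n1 : rhoE ^+ n.-1 = w *: rhoV.
Proof.
by rewrite -[LHS]mulr1 -rhoE_mul_rhoV mulrA -exprSr prednK // rhoE_n mulr_algl.
Qed.

(** * Reassociation and the two sides of coassociativity *)

Definition reassocE (F : elt (tensAlg HH A)) : elt HHA := reassoc F.

Lemma reassocE_linear : linear reassocE.
Proof. by move=> c f h; apply/ffunP => q; rewrite !ffunE. Qed.

HB.instance Definition _ :=
  GRing.isLinear.Build K (elt (tensAlg HH A)) (elt HHA) _ reassocE reassocE_linear.

Lemma reassocE_tens (f h : elt H) (k : elt A) :
  reassocE (tensE (tensE f h : elt HH) k) = tensE f (tensE h k : elt HA).
Proof. by apply/ffunP => q; rewrite !ffunE /= mulrA. Qed.

Lemma reassocE_mul : {morph reassocE : f h / f * h}.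
Proof.
apply: linear_mul_basis => p q /=.
by rewrite !tensE_eltb !tensE_mul !reassocE_tens !tensE_mul.
Qed.

Lemma reassocE_exp f k : reassocE (f ^+ k) = reassocE f ^+ k.
Proof.
elim: k => [|k IHk]; last by rewrite !exprS reassocE_mul IHk.
by rewrite !expr0 -!tensE11 reassocE_tens.
Qed.

Lemma rho_bvec (c : BA n) : rho w (bvec K c) = rhoE ^+ c.
Proof.
rewrite /rho (bigD1 c) //= big1 ?addr0 => [|d /negbTE dc].
  by rewrite ffunE eqxx -(cpowE rhoE); apply/ffunP => q; rewrite ffunE mul1r.
by apply/ffunP => q; rewrite !ffunE dc mul0r.
Qed.

Lemma id_rhoE (F : elt HA) : id_rho w F =
  HAmorph (tensE (gxE 1 0) 1 : elt HHA) (tensE (gxE 0 1) 1) (tensE 1 rhoE) F.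
Proof.
apply: eq_bigr => p _; rewrite rho_bvec bvec_gxH.
by rewrite !tensEX !tensE_mul gxE_gx !expr1n !mulr1 mul1r.
Qed.

(** The monomials in Delta(g), Delta(x) and u are formed in (H ⊗ H) ⊗ A, then carried over factor by
    factor since [reassocE] is multiplicative. *)
Lemma Delta_idE (F : elt HA) : Delta_id w F =
  HAmorph (tensE (gxE 1 0) (tensE (gxE 1 0) 1 : elt HA) : elt HHA)
    (tensE (gxE 0 1) 1 + tensE (gxE 1 0) (tensE (gxE 0 1) 1 : elt HA))
    (tensE 1 (tensE 1 (uE 1) : elt HA)) F.
Proof.
apply: eq_bigr => p _; congr scl.
pose Dg : elt HH := tensE (gxE 1 0) (gxE 1 0).
pose Dx : elt HH := tensE (gxE 0 1) 1 + tensE (gxE 1 0) (gxE 0 1).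
have -> : Delta_basis w p.1 = Dg ^+ p.1.1 * Dx ^+ p.1.2.
  rewrite /Delta_basis /Delta_g /Delta_x !gH_gxE !xH_gxE.
  by rewrite -(cpowE Dg) -(cpowE Dx).
have tensE_DgDxu (a b c : nat) : tensE (Dg ^+ a * Dx ^+ b) (uE c) =
    tensE Dg 1 ^+ a * tensE Dx 1 ^+ b * tensE 1 (uE 1) ^+ c :> elt (tensAlg HH A).
  by rewrite !tensEX !tensE_mul !expr1n !mulr1 mul1r uE_X muln1.
rewrite bvec_uXA; transitivity (reassocE (tensE (Dg ^+ p.1.1 * Dx ^+ p.1.2) (uE p.2))) => //.
rewrite tensE_DgDxu !reassocE_mul !reassocE_exp -(tensE11 H H) tensEDl.
by rewrite linearD /= !reassocE_tens tensE11.
Qed.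

Lemma coassoc_prim : comodule_coassoc n w.
Proof.
move=> f.
have -> : rho w f = \sum_c f c *: rhoE ^+ c :> elt HA.
  by apply: eq_bigr => c _; rewrite -(cpowE rhoE).
rewrite id_rhoE Delta_idE.
(* Index 1 marks the images of the generators under id ⊗ rho, index 2 those under Delta ⊗ id. Each
   triple must satisfy the relations of H ⊗ A. *)
set g1 := tensE (gxE 1 0) 1; set x1 := tensE (gxE 0 1) 1; set u1 := tensE 1 rhoE.
set g2 := tensE (gxE 1 0) (tensE (gxE 1 0) 1).
set x2 := x1 + _; set u2 := tensE 1 (tensE 1 (uE 1)).
have gn : gxE 1 0 ^+ n = 1.
  by rewrite gxE_g muln1 -[n in gxE n]mul1n -[(1 * n)%N]add0n gxE_addn gxE00.
have xn : gxE 0 1 ^+ n = 0 by rewrite gxE_x gxE_eq0.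
have xg : gxE 0 1 * gxE 1 0 = w *: (gxE 1 0 * gxE 0 1).
  by rewrite !gxE_mul expr1 expr0 scale1r.
have g1n : g1 ^+ n = 1 by rewrite tensEX gn expr1n.
have x1n : x1 ^+ n = 0 by rewrite tensEX xn tensE0l.
have u1n : u1 ^+ n = w%:A by rewrite tensEX rhoE_n expr1n tensEZr.
have x1g1 : x1 * g1 = w *: (g1 * x1) by rewrite !tensE_mul xg tensEZl.
have u1g1 : u1 * g1 = g1 * u1 by rewrite !tensE_mul !mulr1 !mul1r.
have u1x1 : u1 * x1 = x1 * u1 by rewrite !tensE_mul !mulr1 !mul1r.
have g2n : g2 ^+ n = 1 by rewrite !tensEX gn expr1n.
(* The summands g ⊗ x ⊗ 1 and x ⊗ 1 ⊗ 1 w-commute and both have n-th power 0. *)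
have x2n : x2 ^+ n = 0.
  rewrite /x2 addrC (exprDn_prim prim_w) ?x1n ?addr0.
    by rewrite !tensEX xn tensE0l tensE0r.
  by rewrite !tensE_mul xg tensEZl ?mul1r ?mulr1.
have u2n : u2 ^+ n = w%:A.
  rewrite !tensEX uE_X muln1 -[n in uE n]mul1n -[(1 * n)%N]add0n uE_addn uE0 !expr1n.
  by rewrite !tensEZr.
have x2g2 : x2 * g2 = w *: (g2 * x2).
  rewrite mulrDl mulrDr !tensE_mul xg tensEZl !mul1r !mulr1 scalerDr; congr (_ + _).
  by rewrite tensEZl tensEZr.
have u2g2 : u2 * g2 = g2 * u2 by rewrite !tensE_mul !mulr1 !mul1r.
have u2x2 : u2 * x2 = x2 * u2 by rewrite mulrDl mulrDr !tensE_mul !mulr1 !mul1r.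
have M1 := HAmorph_gxuE g1n x1n u1n; have M2 := HAmorph_gxuE g2n x2n u2n.
have X1 := HAmorphX g1n x1n u1n x1g1 u1g1 u1x1.
have X2 := HAmorphX g2n x2n u2n x2g2 u2g2 u2x2.
(* Both sides equal g ⊗ g ⊗ u^-1 + (1 - w) (g ⊗ x ⊗ 1 + x ⊗ 1 ⊗ 1); on the left, g ⊗ [rhoV] supplies
   the first two terms. *)
have eqV : HAmorph g1 x1 u1 rhoV = HAmorph g2 x2 u2 rhoV.
  rewrite /rhoV !HAmorphD !HAmorphZ !M1 !M2 !expr0 !expr1 !mulr1 !mul1r.
  rewrite !tensEX !tensE_mul !expr1n !mulr1 !mul1r rhoE_n1 uE_X muln1 tensEZr scalerA.
  rewrite mulVf // scale1r /rhoV tensEDr !tensEZr scalerDr -addrA; congr (_ + _).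
  by rewrite addrC /gxuE uE0.
have eqE : HAmorph g1 x1 u1 rhoE = HAmorph g2 x2 u2 rhoE.
  by rewrite rhoE_rhoV !HAmorphZ X1 X2 eqV.
rewrite !linear_sum; apply: eq_bigr => c _.
by rewrite /= !HAmorphZ X1 X2 eqE.
Qed.

End TaftCoaction.

Theorem theorem3p9 (K : fieldType) (n : nat) (w : K) :
  [pchar K] =i pred0 -> n.-primitive_root w ->
  (comodule_coassoc n w <-> comb_cond n w).
Proof.
by move=> _ prim_w; split=> _; [apply: comb_cond_prim | apply: coassoc_prim].
Qed.
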